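(* Let $\mathcal{B}=(\mathcal{O},\mathscr{C},\mathfrak{R},I,T)$ be an unambiguous bud generating system, with $\mathscr{C}=\{c_1,\dots,c_k\}$, such that $\mathcal{O}$ is a locally finite operad and $\mathfrak{R}(1)$ finitely factorizes $\mathbf{Bud}_{\mathscr{C}}(\mathcal{O})$. Let $\mathbf{f}$ be the series of $\mathbb{K}[[\mathbb{X}_{\mathscr{C}}\sqcup\mathbb{Y}_{\mathscr{C}}]]$ satisfying, for any $a\in\mathscr{C}$ and any type $\alpha\in\mathcal{T}_{\mathscr{C}}$, $$\langle\mathsf{x}_a\mathbb{Y}_{\mathscr{C}}^\alpha,\mathbf{f}\rangle=\delta_{\alpha,\mathrm{type}(a)}+\sum_{\substack{\phi:\mathscr{C}\times\mathcal{T}_{\mathscr{C}}\to\mathbb{N}\\ \alpha=\phi^{(c_1)}\dots\phi^{(c_k)}}}\chi_{a,\,\sum\phi_{c_1}\dots\sum\phi_{c_k}}\Bigl(\prod_{b\in\mathscr{C}}\phi_b!\Bigr)\Bigl(\prod_{\substack{b\in\mathscr{C}\\ \gamma\in\mathcal{T}_{\mathscr{C}}}}\langle\mathsf{x}_b\mathbb{Y}_{\mathscr{C}}^\gamma,\mathbf{f}\rangle^{\phi(b,\gamma)}\Bigr).$$ Then, for any color $a\in I$ and any type $\alpha\in\mathcal{T}_{\mathscr{C}}$ such that $\mathscr{C}^\alpha\in T^+$, the coefficients $\langle\mathsf{x}_a\mathbb{Y}_{\mathscr{C}}^\alpha,\mathrm{colt}(\mathrm{synt}(\mathcal{B}))\rangle$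 and $\langle\mathsf{x}_a\mathbb{Y}_{\mathscr{C}}^\alpha,\mathbf{f}\rangle$ are equal.
   Context: Colored operads. Let $\mathscr{C}=\{c_1,\dots,c_k\}$ be a finite set of colors. A $\mathscr{C}$-colored operad $\mathcal{C}=\bigsqcup_{n\geq1}\mathcal{C}(n)$ is a nonsymmetric colored set-operad: each $x\in\mathcal{C}(n)$ has arity $|x|=n$, an output color $\mathrm{out}(x)\in\mathscr{C}$ and a word of input colors $\mathrm{in}(x)\in\mathscr{C}^n$ with $i$-th letter $\mathrm{in}_i(x)$; $x\circ_i y\in\mathcal{C}(|x|+|y|-1)$ is defined iff $\mathrm{out}(y)=\mathrm{in}_i(x)$; there are units $\mathbf{1}_a\in\mathcal{C}(1)$, $a\in\mathscr{C}$, with output and input color $a$; the usual associativity and unit axioms hold. The complete composition is $x\circ[y_1,\dots,y_n]:=(\cdots((x\circ_n y_n)\circ_{n-1}y_{n-1})\cdots)\circ_1 y_1$ (defined when $\mathrm{out}(y_i)=\mathrm{in}_i(x)$ for all $i$). A (monochrome) operad is the case of a single color. $\mathcal{C}$ is locally finite if every $\mathcal{C}(n)$ is finite. Bud operads. For an operad $\mathcal{O}$ with unit $\mathbf{1}$, $\mathbf{Bud}_{\mathscr{C}}(\mathcal{O})$ is the $\mathscr{C}$-colored operad of triples $(a,x,u)\in\mathscr{C}\times\mathcal{O}(n)\times\mathscr{C}^n$, $n\geq1$, with output color $a$, input colors $u$, units $\mathbf{1}_a=(a,\mathbf{1},a)$, and $(a,x,u)\circ_i(b,y,v)=(a,x\circ_i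 y,u')$ when $b=u_i$, where $u'$ is $u$ with its $i$-th letter replaced by $v$. A bud generating system is a tuple $\mathcal{B}=(\mathcal{O},\mathscr{C},\mathfrak{R},I,T)$ with $\mathcal{O}$ an operad, $\mathscr{C}$ a finite set of colors, $\mathfrak{R}$ a finite subset of $\mathbf{Bud}_{\mathscr{C}}(\mathcal{O})$ (rules) and $I,T\subseteq\mathscr{C}$. $T^+$ is the set of nonempty words on $T$. Finite factorization. For a subset $S$ of a $\mathscr{C}$-colored operad $\mathcal{C}$, $S(1)$ is the set of its elements of arity $1$, and $\mathbf{Free}(S)$ is the set of planar rooted trees whose internal nodes with $n\geq1$ children are labeled by arity-$n$ elements of $S$, such that if $v$ is the $i$-th child of $u$ (both internal) then the output color of the label of $v$ is the $i$-th input color of the label of $u$; it contains, for each color $a$, a tree consisting of one leaf with output and input color $a$. The evaluation $\mathrm{ev}_{\mathcal{C}}(\mathfrak{t})\in\mathcal{C}$ is obtained by composing in $\mathcal{C}$ the labels along $\mathfrak{t}$ (the one-leaf tree of color $a$ evaluates to $\mathbf{1}_a$). $S$ finitely factorizes $\mathcal{C}$ if for each $x\in\mathcal{C}$ there are finitely many $\mathfrak{t}\in\mathbf{Free}(S)$ with $\mathrm{ev}_{\mathcal{C}}(\mathfrak{t})=x$. Series. $\mathbb{K}$ is a field of characteristic zero. A $\mathcal{C}$-series is a map $\mathbf{f}:\mathcal{C}\to\mathbb{K}$, with values denoted $\langle x,\mathbf{f}\rangle$. The characteristic series of a subset is its indicator function. $\mathbf{u}$ is the characteristic series of $\{\mathbf{1}_a:a\in\mathscr{C}\}$.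 Composition product: $\langle x,\mathbf{f}\odot\mathbf{g}\rangle:=\sum_{y,z_1,\dots,z_{|y|}\in\mathcal{C},\,x=y\circ[z_1,\dots,z_{|y|}]}\langle y,\mathbf{f}\rangle\prod_{i}\langle z_i,\mathbf{g}\rangle$; on a locally finite colored operad it is associative with unit $\mathbf{u}$. The $\odot$-inverse $\mathbf{f}^{\odot_{-1}}$ of $\mathbf{f}$, when it exists, is the unique series $\mathbf{x}$ with $\mathbf{f}\odot\mathbf{x}=\mathbf{u}=\mathbf{x}\odot\mathbf{f}$. Let $\mathbf{r}$, $\mathbf{i}$, $\mathbf{t}$ be the characteristic series of $\mathfrak{R}$, $\{\mathbf{1}_a:a\in I\}$, $\{\mathbf{1}_a:a\in T\}$ in $\mathbf{Bud}_{\mathscr{C}}(\mathcal{O})$. The syntactic generating series is $\mathrm{synt}(\mathcal{B}):=\mathbf{i}\odot(\mathbf{u}-\mathbf{r})^{\odot_{-1}}\odot\mathbf{t}$ (well-defined when $\mathcal{O}$ is locally finite and $\mathfrak{R}(1)$ finitely factorizes $\mathbf{Bud}_{\mathscr{C}}(\mathcal{O})$). $\mathcal{B}$ is unambiguous if all coefficients of $\mathrm{synt}(\mathcal{B})$ are equal to $0$ or $1$. Types. The type of a nonempty word $u$ on $\mathscr{C}$ is $\mathrm{type}(u)=|u|_{c_1}\dots|u|_{c_k}\in\mathbb{N}^k$, where $|u|_c$ is the number of occurrences of $c$ in $u$. $\mathcal{T}_{\mathscr{C}}$ is the set of all types, i.e. of all nonzero elements of $\mathbb{N}^k$ (written as words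 of length $k$). For a type $\alpha$, $\mathscr{C}^\alpha$ is the word $c_1^{\alpha_1}\dots c_k^{\alpha_k}$. $\mathbb{X}_{\mathscr{C}}=\{\mathsf{x}_{c_1},\dots,\mathsf{x}_{c_k}\}$ and $\mathbb{Y}_{\mathscr{C}}=\{\mathsf{y}_{c_1},\dots,\mathsf{y}_{c_k}\}$ are sets of commuting variables, $\mathbb{Y}_{\mathscr{C}}^\alpha=\mathsf{y}_{c_1}^{\alpha_1}\cdots\mathsf{y}_{c_k}^{\alpha_k}$, and $\langle m,\mathbf{s}\rangle$ is the coefficient of the monomial $m$ in $\mathbf{s}$. The series of color types of a $\mathcal{C}$-series $\mathbf{g}$ is $\mathrm{colt}(\mathbf{g})=\sum_{x\in\mathcal{C}}\langle x,\mathbf{g}\rangle\,\mathsf{x}_{\mathrm{out}(x)}\,\mathbb{Y}_{\mathscr{C}}^{\mathrm{type}(\mathrm{in}(x))}$. Notation. $\chi_{a,\gamma}:=\#\{r\in\mathfrak{R}:\mathrm{out}(r)=a,\ \mathrm{type}(\mathrm{in}(r))=\gamma\}$. The maps $\phi:\mathscr{C}\times\mathcal{T}_{\mathscr{C}}\to\mathbb{N}$ considered are those with $\phi(b,\gamma)\neq0$ for finitely many pairs only. For such $\phi$ and $a\in\mathscr{C}=\{c_1,\dots,c_k\}$, with $\gamma_a$ denoting the component of $\gamma$ corresponding to color $a$: $\phi^{(a)}:=\sum_{b\in\mathscr{C},\gamma\in\mathcal{T}_{\mathscr{C}}}\phi(b,\gamma)\gamma_a$; $\phi_a$ is the multiset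 of the values $\phi(a,\gamma)$, $\gamma\in\mathcal{T}_{\mathscr{C}}$; $\sum\phi_a:=\sum_{\gamma}\phi(a,\gamma)$; and $\phi_a!$ is the multinomial coefficient $\bigl(\sum_\gamma\phi(a,\gamma)\bigr)!\big/\prod_\gamma\phi(a,\gamma)!$. $\phi^{(c_1)}\dots\phi^{(c_k)}$ and $\sum\phi_{c_1}\dots\sum\phi_{c_k}$ denote elements of $\mathbb{N}^k$ written as words. $\delta$ is the Kronecker delta and $0^0=1$. *)

(* Defs.v *)
From HB Require Import structures.
From mathcomp Require Import all_boot all_order all_algebra.
From mathcomp Require Import finmap.
From mathcomp Require Import zify.
From mathcomp Require Import mathcomp_extra boolp classical_sets cardinality.
From mathcomp Require Import fsbigop.

Set Implicit Arguments.
Unset Strict Implicit.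
Unset Printing Implicit Defensive.

Import GRing.Theory.

Local Open Scope classical_set_scope.
Local Open Scope ring_scope.

(** ** Colored operads *)

Definition splice {T : Type} (u : seq T) (i : nat) (v : seq T) : seq T :=
  take i u ++ v ++ drop i.+1 u.

(* Inputs are numbered from 0. The partial composition x o_i y is an [option]:
   it is [Some _] exactly when the i-th input color of x exists and is the
   output color of y. The two associativity axioms are equalities of partial
   operations: one side is defined iff the other one is. *)
Record coperad (C : finType) := COperad {
  op_carrier :> choiceType;
  out : op_carrier -> C;
  inp : op_carrier -> seq C;
  op1 : C -> op_carrier;
  pcomp : op_carrier -> nat -> op_carrier -> option op_carrier;
  inp_gt0 : forall x, (0 < size (inp x))%N;
  out_op1 : forall a, out (op1 a) = a;
  inp_op1 : forall a, inp (op1 a) = [:: a];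
  pcomp_def : forall x i y,
    isSome (pcomp x i y) = (onth (inp x) i == Some (out y));
  out_pcomp : forall x i y z, pcomp x i y = Some z -> out z = out x;
  inp_pcomp : forall x i y z,
    pcomp x i y = Some z -> inp z = splice (inp x) i (inp y);
  pcompA : forall x i y j z, (j < size (inp y))%N ->
    obind (fun w => pcomp w (i + j)%N z) (pcomp x i y) =
    obind (fun w => pcomp x i w) (pcomp y j z);
  pcompAC : forall x i y k z, (i < k)%N ->
    obind (fun w => pcomp w (k + size (inp y)).-1 z) (pcomp x i y) =
    obind (fun w => pcomp w i y) (pcomp x k z);
  pcomp1x : forall x, pcomp (op1 (out x)) 0 x = Some x;
  pcompx1 : forall x i a,
    onth (inp x) i = Some a -> pcomp x i (op1 a) = Some x
}.

Definition operad := coperad unit.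

Section ColoredOperad.
Context {C : finType} {X : coperad C}.

Definition arity (x : X) : nat := size (inp x).

(* The innermost composition of the [foldr] is the one at the last input. *)
Definition ccomp (x : X) (ys : seq X) : option X :=
  if map (@out C X) ys == inp x then
    foldr (fun iy acc => obind (fun w => pcomp w iy.1 iy.2) acc) (Some x)
          (zip (iota 0 (size ys)) ys)
  else None.

End ColoredOperad.

Definition locally_finite (C : finType) (X : coperad C) : Prop :=
  forall n : nat, finite_set [set x : X | arity x = n].

(** ** Free colored operads and finite factorization *)

Inductive stree (C X : Type) : Type :=
| Leaf of C
| Node of X & seq (stree C X).
Arguments Leaf {C X}.
Arguments Node {C X}.

Definition oseq {T : Type} (s : seq (option T)) : option (seq T) :=
  foldr (fun o acc => obind (fun x => omap (cons x) acc) o) (Some [::]) s.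

Section Trees.
Context {C : finType} {X : coperad C}.

Definition tree_out (t : stree C X) : C :=
  match t with Leaf a => a | Node x _ => out x end.

(* The leaves of a tree carry their color, which [in_Free] forces to be the
   input color of the parent they are attached to. *)
Fixpoint in_Free (S : set X) (t : stree C X) : Prop :=
  match t with
  | Leaf _ => True
  | Node x ts => [/\ S x, map tree_out ts = inp x
                  & foldr (fun t' P => in_Free S t' /\ P) True ts]
  end.

Definition Free (S : set X) : set (stree C X) := [set t | in_Free S t].

Fixpoint ev (t : stree C X) : option X :=
  match t with
  | Leaf a => Some (op1 X a)
  | Node x ts => obind (ccomp x) (oseq (map ev ts))
  end.

Definition finitely_factorizes (S : set X) : Prop :=
  forall x : X, finite_set [set t | Free S t /\ ev t = Some x].

End Trees.

(** ** Bud operads *)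

Lemma size_splice (T : Type) (u : seq T) i v :
  (i < size u)%N -> size (splice u i v) = (size u + size v).-1.
Proof.
by move=> iu; rewrite /splice !size_cat size_take size_drop iu; lia.
Qed.

Lemma onth_size (T : Type) (u : seq T) i a : onth u i = Some a -> (i < size u)%N.
Proof. by move=> h; rewrite -onthTE h. Qed.

Lemma onth_unit (u : seq unit) i : (i < size u)%N -> onth u i = Some tt.
Proof. by rewrite -onthTE; case: (onth u i) => // -[]. Qed.

Lemma onth_split (T : Type) (u : seq T) i a : onth u i = Some a ->
  exists p q, u = p ++ a :: q /\ i = size p.
Proof.
move=> ua; have iu := onth_size ua.
exists (take i u), (drop i.+1 u).
by rewrite -[X in X :: _](@onth_nth _ a a u i ua) -drop_nth // cat_take_drop size_takel // ltnW.
Qed.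

Lemma splice_cat (T : Type) (p q v : seq T) a :
  splice (p ++ a :: q) (size p) v = p ++ v ++ q.
Proof.
rewrite /splice take_size_cat // -cat_rcons drop_size_cat //.
by rewrite size_rcons.
Qed.

Lemma onth_cat_l (T : Type) (p q : seq T) i :
  (i < size p)%N -> onth (p ++ q) i = onth p i.
Proof. by rewrite onth_cat => ->. Qed.

Lemma onth_cat_r (T : Type) (p q : seq T) i :
  onth (p ++ q) (size p + i)%N = onth q i.
Proof. by rewrite onth_cat addKn ltnNge leq_addr. Qed.

Lemma onth_splice_in (T : Type) (u v : seq T) i j : (i < size u)%N ->
  (j < size v)%N -> onth (splice u i v) (i + j)%N = onth v j.
Proof.
move=> iu jv; rewrite /splice onth_cat (size_takel (ltnW iu)).
by rewrite ltnNge leq_addr /= addKn onth_cat_l.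
Qed.

Lemma onth_splice_right (T : Type) (u v : seq T) i k : (i < size u)%N ->
  (i < k)%N -> onth (splice u i v) (k + size v).-1 = onth u k.
Proof.
move=> iu ik; have ui : size (take i u) = i by rewrite size_takel // ltnW.
have -> : (k + size v).-1 = (size (take i u) + (size v + (k - i.+1)))%N.
  by rewrite ui; lia.
rewrite /splice !onth_cat_r -[in RHS](cat_take_drop i.+1 u).
have {2}-> : k = (size (take i.+1 u) + (k - i.+1))%N.
  by rewrite size_takel //; lia.
by rewrite onth_cat_r.
Qed.

Lemma onth_splice_left (T : Type) (u v : seq T) i k : (k < size u)%N ->
  (i < k)%N -> onth (splice u k v) i = onth u i.
Proof.
move=> ku ik; have uk : size (take k u) = k by rewrite size_takel // ltnW.
by rewrite /splice onth_cat_l ?uk // -[in RHS](cat_take_drop k u) onth_cat_l ?uk.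
Qed.

Lemma spliceA (T : Type) (u v w : seq T) i j : (i < size u)%N ->
  (j < size v)%N ->
  splice (splice u i v) (i + j) w = splice u i (splice v j w).
Proof.
rewrite -!onthTE; case ua: (onth u i) => [a|] // _; case vb: (onth v j) => [b|] // _.
have [p [q [-> ->]]] := onth_split ua.
have [p' [q' [-> ->]]] := onth_split vb.
by rewrite !splice_cat -size_cat -catA /= catA splice_cat -!catA.
Qed.

Lemma spliceAC (T : Type) (u v w : seq T) i k : (i < k)%N -> (k < size u)%N ->
  splice (splice u i v) (k + size v).-1 w = splice (splice u k w) i v.
Proof.
move=> ik; rewrite -onthTE; case ua: (onth u k) => [a|] // _.
have [p [q [-> kE]]] := onth_split ua.
have : isSome (onth p i) by rewrite onthTE -kE.
case pb: (onth p i) => [b|] // _.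
have [p1 [p2 [pE iE]]] := onth_split pb.
rewrite kE splice_cat pE iE.
have -> : (size (p1 ++ b :: p2) + size v).-1 = size (p1 ++ v ++ p2).
  by rewrite !size_cat /=; lia.
have -> : splice ((p1 ++ b :: p2) ++ a :: q) (size p1) v =
          (p1 ++ v ++ p2) ++ a :: q by rewrite -catA /= splice_cat -!catA.
by rewrite splice_cat -!catA /= splice_cat.
Qed.

Lemma obindP (S T : Type) (f : S -> option T) o t :
  obind f o = Some t <-> exists2 s, o = Some s & f s = Some t.
Proof. by case: o => [s|]; split => [|[]] //= => [|s' [<-]] //; exists s. Qed.

Lemma option_ext (T : Type) (o1 o2 : option T) :
  (forall t, o1 = Some t <-> o2 = Some t) -> o1 = o2.
Proof.
case: o1 o2 => [t|] [s|] // h;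
  by [exact/esym/h|have/h := erefl (Some t)|have/h := erefl (Some s)].
Qed.

Section Bud.
Context (C : finType) (O : operad).

Definition bud_pred (p : C * O * seq C) : bool := size p.2 == arity p.1.2.

Definition bud_elt := {p : C * O * seq C | bud_pred p}.

Definition bud_out (x : bud_elt) : C := (val x).1.1.
Definition bud_op (x : bud_elt) : O := (val x).1.2.
Definition bud_inp (x : bud_elt) : seq C := (val x).2.

Lemma bud1_subproof (a : C) : bud_pred (a, op1 O tt, [:: a]).
Proof. by rewrite /bud_pred /arity /= inp_op1. Qed.

Definition bud1 (a : C) : bud_elt := Sub (a, op1 O tt, [:: a]) (bud1_subproof a).

(* [insub] never fails here: see [bud_pcomp_def] below. *)
Definition bud_pcomp (x : bud_elt) (i : nat) (y : bud_elt) : option bud_elt :=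
  if onth (bud_inp x) i == Some (bud_out y) then
    obind (fun w => insub (bud_out x, w, splice (bud_inp x) i (bud_inp y)))
          (pcomp (bud_op x) i (bud_op y))
  else None.

Lemma size_bud_inp (x : bud_elt) : size (bud_inp x) = arity (bud_op x).
Proof. exact/eqP/(valP x). Qed.

Lemma op_pcomp_def (x y : O) i :
  isSome (pcomp x i y) = (i < arity x)%N.
Proof.
rewrite pcomp_def /arity -onthTE.
by case: (onth _ _) => [[]|] //=; case: (out y).
Qed.

Lemma size_pcomp (x y : O) i w :
  pcomp x i y = Some w -> arity w = (arity x + arity y).-1.
Proof.
move=> h; rewrite /arity (inp_pcomp h) size_splice //.
by rewrite -/(arity x) -(op_pcomp_def x y) h.
Qed.

Lemma bud_pcompE x i y z : bud_pcomp x i y = Some z <->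
  [/\ onth (bud_inp x) i = Some (bud_out y), bud_out z = bud_out x,
      bud_inp z = splice (bud_inp x) i (bud_inp y) &
      pcomp (bud_op x) i (bud_op y) = Some (bud_op z)].
Proof.
rewrite /bud_pcomp; split.
  case: eqP => // xy; case E: pcomp => [w|] //= /eqP.
  case: insubP => // u _ uE /eqP[<-].
  by rewrite /bud_out /bud_inp /bud_op uE.
case=> -> zo zi ->; rewrite eqxx /= -zo -zi.
suff -> : (bud_out z, bud_op z, bud_inp z) = val z by rewrite valK.
by rewrite /bud_out /bud_inp /bud_op; case: (val z) => [[]].
Qed.

Lemma bud_pcomp_def x i y :
  isSome (bud_pcomp x i y) = (onth (bud_inp x) i == Some (bud_out y)).
Proof.
rewrite /bud_pcomp; case: eqP => // xy.
have ix : (i < size (bud_inp x))%N := onth_size xy.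
have := op_pcomp_def (bud_op x) (bud_op y) i.
rewrite -size_bud_inp ix; case E: pcomp => [w|] //= _.
case: insubP => // /negP[].
by rewrite /bud_pred /= size_splice // !size_bud_inp (size_pcomp E).
Qed.

Lemma bud_defined x i y : onth (bud_inp x) i = Some (bud_out y) ->
  exists z, bud_pcomp x i y = Some z.
Proof.
move=> /eqP; rewrite -bud_pcomp_def.
by case: bud_pcomp => // z _; exists z.
Qed.

Lemma bud_pcompA x i y j z : (j < size (bud_inp y))%N ->
  obind (fun w => bud_pcomp w (i + j)%N z) (bud_pcomp x i y) =
  obind (fun w => bud_pcomp x i w) (bud_pcomp y j z).
Proof.
move=> jy; have jy' : (j < size (inp (bud_op y)))%N by rewrite size_bud_inp in jy.
have A := pcompA (bud_op x) i (bud_op z) jy'.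
apply: option_ext => t; split => /obindP[w].
  case/bud_pcompE => xy wo wi wE /bud_pcompE [wz to ti tE].
  have ix := onth_size xy.
  have yz : onth (bud_inp y) j = Some (bud_out z).
    by rewrite -wz wi onth_splice_in.
  have [v vE] := bud_defined yz; apply/obindP; exists v => //.
  have [_ vo vi vO] := (bud_pcompE _ _ _ _).1 vE.
  apply/bud_pcompE; split; rewrite ?vo ?to ?ti ?wi ?vi ?spliceA //.
  by move: A; rewrite wE vO /= tE.
case/bud_pcompE => yz wo wi wE /bud_pcompE [xw to ti tE].
have xy : onth (bud_inp x) i = Some (bud_out y) by rewrite xw wo.
have ix := onth_size xy.
have [v vE] := bud_defined xy; apply/obindP; exists v => //.
have [_ vo vi vO] := (bud_pcompE _ _ _ _).1 vE.
apply/bud_pcompE; split; rewrite ?vo ?to ?ti ?wi ?vi ?spliceA ?onth_splice_in //.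
by move: A; rewrite wE vO /= tE.
Qed.

Lemma bud_pcompAC x i y k z : (i < k)%N ->
  obind (fun w => bud_pcomp w (k + size (bud_inp y)).-1 z) (bud_pcomp x i y) =
  obind (fun w => bud_pcomp w i y) (bud_pcomp x k z).
Proof.
move=> ik; have A := pcompAC (bud_op x) (bud_op y) (bud_op z) ik.
rewrite -/(arity _) -size_bud_inp in A.
apply: option_ext => t; split => /obindP[w].
  case/bud_pcompE => xy wo wi wE /bud_pcompE [wz to ti tE].
  have ix := onth_size xy.
  have xz : onth (bud_inp x) k = Some (bud_out z).
    by rewrite -wz wi onth_splice_right.
  have kx := onth_size xz.
  have [v vE] := bud_defined xz; apply/obindP; exists v => //.
  have [_ vo vi vO] := (bud_pcompE _ _ _ _).1 vE.
  apply/bud_pcompE; split;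
    rewrite ?vo ?to ?ti ?wi ?vi ?spliceAC ?onth_splice_left //.
  by move: A; rewrite wE vO /= tE.
case/bud_pcompE => xz wo wi wE /bud_pcompE [wy to ti tE].
have kx := onth_size xz.
have xy : onth (bud_inp x) i = Some (bud_out y).
  by rewrite -wy wi onth_splice_left.
have ix := onth_size xy.
have [v vE] := bud_defined xy; apply/obindP; exists v => //.
have [_ vo vi vO] := (bud_pcompE _ _ _ _).1 vE.
apply/bud_pcompE; split;
  rewrite ?vo ?to ?ti ?wi ?vi ?spliceAC ?onth_splice_right //.
by move: A; rewrite wE vO /= tE.
Qed.

Lemma bud_inp_gt0 x : (0 < size (bud_inp x))%N.
Proof. by rewrite size_bud_inp inp_gt0. Qed.

Lemma bud_out1 a : bud_out (bud1 a) = a. Proof. by []. Qed.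

Lemma bud_inp1 a : bud_inp (bud1 a) = [:: a]. Proof. by []. Qed.

Lemma bud_out_pcomp x i y z : bud_pcomp x i y = Some z -> bud_out z = bud_out x.
Proof. by case/bud_pcompE. Qed.

Lemma bud_inp_pcomp x i y z :
  bud_pcomp x i y = Some z -> bud_inp z = splice (bud_inp x) i (bud_inp y).
Proof. by case/bud_pcompE. Qed.

Lemma bud_pcomp1x x : bud_pcomp (bud1 (bud_out x)) 0 x = Some x.
Proof.
apply/bud_pcompE; split => //; first by rewrite /splice cats0.
by rewrite -[RHS]pcomp1x; case: (out _).
Qed.

Lemma bud_pcompx1 x i a :
  onth (bud_inp x) i = Some a -> bud_pcomp x i (bud1 a) = Some x.
Proof.
move=> xa; apply/bud_pcompE; split => //.
  by have [p [q [-> ->]]] := onth_split xa; rewrite splice_cat.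
apply: pcompx1; apply: onth_unit.
by rewrite -/(arity _) -size_bud_inp (onth_size xa).
Qed.

Definition Bud : coperad C :=
  COperad bud_inp_gt0 bud_out1 bud_inp1 bud_pcomp_def bud_out_pcomp
    bud_inp_pcomp bud_pcompA bud_pcompAC bud_pcomp1x bud_pcompx1.

End Bud.

(** ** Series on colored operads *)

Definition series (K : fieldType) (C : finType) (X : coperad C) := X -> K.

Section Series.
Context {K : fieldType} {C : finType} {X : coperad C}.
Implicit Types (f g : series K X).

Definition charser (A : set X) : series K X := fun x => (x \in A)%:R.

Definition useries : series K X := charser [set op1 X a | a in [set: C]].

(* [\sum_(_ \in _)] is the sum of a finitely supported family (and 0 if the
   support is infinite); the supports are finite when X is locally finite. *)
Definition oprod f g : series K X := fun x =>
  \sum_(yz \in [set yz : X * seq X | ccomp yz.1 yz.2 = Some x])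
     (f yz.1 * \prod_(z <- yz.2) g z).

(* The value is 0 when f is not invertible. *)
Definition oinv f : series K X :=
  xget (fun=> 0) [set g | oprod f g = useries /\ oprod g f = useries].

End Series.

Arguments charser K {C X} A.
Arguments useries K {C} X.

(** ** Types and commutative series *)

Definition wtype {C : finType} (u : seq C) : {ffun C -> nat} :=
  [ffun c => count_mem c u].

(* The set of types: the nonzero elements of N^k. *)
Definition ctype (C : finType) :=
  {alpha : {ffun C -> nat} | alpha != [ffun => 0%N]}.

Definition type_word {C : finType} (alpha : {ffun C -> nat}) : seq C :=
  flatten [seq nseq (alpha c) c | c <- enum C].

Definition monomial (V : finType) := {ffun V -> nat}.

Definition fps (K : fieldType) (V : finType) := monomial V -> K.

(* The variables are x_c = [inl c] and y_c = [inr c]. *)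
Definition mono_xY {C : finType} (a : C) (alpha : {ffun C -> nat}) :
    monomial (C + C)%type :=
  [ffun v => match v with inl c => nat_of_bool (c == a) | inr c => alpha c end].

Definition colt {K : fieldType} {C : finType} {X : coperad C}
    (g : series K X) : fps K (C + C)%type := fun m =>
  \sum_(x \in [set x : X | mono_xY (out x) (wtype (inp x)) = m]) g x.

(* u is a nonempty word on A. *)
Definition word_plus {C : finType} (A : {set C}) (u : seq C) : bool :=
  (u != [::]) && all (fun c => c \in A) u.

(** ** Bud generating systems *)

Record bud_system := BudSystem {
  bs_operad : operad;
  bs_colors : finType;
  bs_rules : {fset Bud bs_colors bs_operad};
  bs_init : {set bs_colors};
  bs_term : {set bs_colors}
}.

Definition rules1 (B : bud_system) : set (Bud (bs_colors B) (bs_operad B)) :=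
  [set r | r \in bs_rules B /\ arity r = 1%N].
Arguments rules1 B : clear implicits.

Definition op1s {C : finType} (X : coperad C) (A : {set C}) : set X :=
  [set op1 X a | a in [set a | a \in A]].
Arguments op1s {C} X A.

Definition synt (K : fieldType) (B : bud_system) :
    series K (Bud (bs_colors B) (bs_operad B)) :=
  let X := Bud (bs_colors B) (bs_operad B) in
  let r : series K X := charser K [set r | r \in bs_rules B] in
  oprod
    (oprod (charser K (op1s X (bs_init B)))
           (oinv (fun x => useries K X x - r x)))
    (charser K (op1s X (bs_term B))).
Arguments synt K B : clear implicits.

Definition unambiguous (K : fieldType) (B : bud_system) : Prop :=
  forall x, synt K B x = 0 \/ synt K B x = 1.

Definition chi (B : bud_system) (a : bs_colors B)
    (gamma : {ffun bs_colors B -> nat}) : nat :=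
  #|` [fset r in bs_rules B | (out r == a) && (wtype (inp r) == gamma)]%fset |.

(** ** Finitely supported maps from colors and types to naturals *)

Definition phimap (C : finType) :=
  {fsfun (C * ctype C)%type -> nat with 0%N}.

(* Restricting sums and products over all pairs (b, gamma) to [finsupp phi]
   only drops terms 0 and factors 0! = 1. *)
Section Phi.
Context {C : finType}.
Implicit Types (phi : phimap C) (a : C).

Definition phi_deg phi a : nat :=
  (\sum_(p <- finsupp phi) phi p * val p.2 a)%N.

Definition phi_sum phi a : nat :=
  (\sum_(p <- finsupp phi | p.1 == a) phi p)%N.

(* An exact division. *)
Definition phi_fact phi a : nat :=
  ((phi_sum phi a)`! %/ \prod_(p <- finsupp phi | p.1 == a) (phi p)`!)%N.

End Phi.

(* Main.v *)
Require Import Defs.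
From HB Require Import structures.
From mathcomp Require Import all_boot all_order all_algebra.
From mathcomp Require Import finmap.
From mathcomp Require Import mathcomp_extra boolp classical_sets cardinality.
From mathcomp Require Import fsbigop.
From mathcomp Require Import zify.
(* Imported again so that [pcomp] is the partial composition of an operad and
   not the composition of partial functions. *)
Import Defs.
Import GRing.Theory.
Local Open Scope classical_set_scope.
Local Open Scope ring_scope.

(** Write h for the inverse of u - r. The equation (u - r) o h = u reads
    h = u + r o h, since the composition product is linear on the left: an
    element x is a unit or is decomposed as y o [z_1, ..., z_n] with y a rule.
    Let G(a, alpha) be the sum of h(x) over the x of output color a whose
    input word has type alpha. Summing the equation over these x and expanding
    the products of sums gives ([by_profile_rec])

      G(a, alpha) = [alpha = type(a)]
        + sum over p_1 ... p_n of N(a, colors) * G(p_1) ... G(p_n),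

    where p_1 ... p_n runs over the words of pairs (color, type) whose types
    add up to alpha, and N(a, colors) counts the rules of output a whose
    input word is the word of the colors of the p_i. Grouping these words by
    the multiset phi of their letters turns this recursion into the one
    satisfied by f: among the words with multiset phi, those with a prescribed
    word of colors u, |u|_b being the sum of phi_b, number
    prod_b phi_b! ([nlift_phi], [sum_phi_seqs]).

    The recursion has only one solution. Since the unary rules finitely
    factorize the bud operad, which is locally finite, they form no cycle on
    the colors: a cycle would yield trees of every height evaluating into the
    finite set of elements of arity 1 ([unary_acyclic]). So colors carry a
    rank which drops along unary rules, and the pairs (size, rank), ordered
    lexicographically and encoded as a natural number [weight], drop from
    (a, alpha) to each of the p_i ([weight_lt], [type_rec_unique]).

    The same weight shows that u - r is invertible ([oinv_rules]). Iterating
    h := u + r o h stabilizes at every x and gives a right inverse h of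
    u - r. It is a left inverse as well: by associativity ([oprodA]),
    w = h o (u - r) satisfies w = (u - r) + r o w, an equation which u also
    satisfies and whose solution is unique.

    Finally the factors i and t of the syntactic series only select the
    elements with output color in I and input colors in T ([syntE]), a
    condition met by all the elements counted in G(a, alpha). *)

Set Implicit Arguments.
Unset Strict Implicit.
Unset Printing Implicit Defensive.

(** * Finite sums *)

Section FiniteSums.

(** Summation along the fibers of [pi]; [F i] is the fiber over [i] in [A]. *)
Lemma fsum_fibers (K : nmodType) (D I : choiceType) (A : set D) (B : set I)
    (F : I -> set D) (pi : D -> I) (G : D -> K) :
  finite_set A -> finite_set B -> (forall d, A d -> B (pi d)) ->
  (forall i d, B i -> (F i d <-> A d /\ pi d = i)) ->
  \sum_(d \in A) G d = \sum_(i \in B) \sum_(d \in F i) G d.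
Proof.
move=> fA fB AB FE.
transitivity (\sum_(i \in B) \sum_(d \in A) (if pi d == i then G d else 0)).
  rewrite exchange_fsbig //; apply: eq_fsbigr => d; rewrite inE => Ad.
  rewrite (fsbigD1 (pi d)) //=; last exact: AB.
  rewrite eqxx fsbig1 ?addr0 // => i [_ /= /eqP].
  by rewrite eq_sym => /negPf ->.
apply: eq_fsbigr => i; rewrite inE => Bi.
have -> : F i = A `&` [set d | pi d = i].
  by apply/seteqP; split => d /=; rewrite FE.
rewrite fsbig_mkcondr; apply: eq_fsbigr => d _.
by case: eqP => h; [rewrite mem_set | rewrite memNset].
Qed.

Lemma finite_map_fiber (D I : choiceType) (pi : D -> I) (s : seq I) :
  (forall i, i \in s -> finite_set [set d | pi d = i]) ->
  finite_set [set ds | map pi ds = s].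
Proof.
elim: s => [|i s IH] fs.
  by apply: (sub_finite_set _ (finite_set1 [::])) => -[|].
apply: (sub_finite_set _ (finite_image (fun p : D * seq D => p.1 :: p.2)
  (finite_setX (fs i (mem_head _ _)) (IH _)))).
  by move=> [|d ds] //= [<- <-]; exists (d, ds).
by move=> j js; apply: fs; rewrite inE js orbT.
Qed.

(** Distributivity: a product over a word of sums over fibers of [pi] is the
    sum over the words that [pi] maps letterwise to the given one. *)
Lemma prod_fsum (K : idomainType) (D I : choiceType) (pi : D -> I) (G : D -> K)
    (s : seq I) :
  (forall i, i \in s -> finite_set [set d | pi d = i]) ->
  \prod_(i <- s) \sum_(d \in [set d | pi d = i]) G d =
  \sum_(ds \in [set ds | map pi ds = s]) \prod_(d <- ds) G d.
Proof.
elim: s => [|i s IH] fs.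
  rewrite big_nil (_ : [set _ | _] = [set [::]]) ?fsbig_set1 ?big_nil //.
  by apply/seteqP; split => -[|].
have fs' j : j \in s -> finite_set [set d | pi d = j].
  by move=> js; apply: fs; rewrite inE js orbT.
rewrite big_cons IH // mulr_fsuml; under eq_fsbigr do rewrite mulr_fsumr.
rewrite pair_fsbig; last exact: finite_map_fiber.
  2: exact/fs/mem_head.
rewrite (reindex_fsbig (fun p : D * seq D => p.1 :: p.2)
  ([set d | pi d = i] `*` [set ds | map pi ds = s])).
  by apply: eq_fsbigr => p _; rewrite big_cons.
split.
- by move=> [d ds] /= [-> ->].
- by move=> [d ds] [d' ds'] _ _ /= [-> ->].
- by move=> [|d ds] //= [<- <-]; exists (d, ds).
Qed.

Lemma finite_seqs (T : choiceType) (A : set T) (n : nat) : finite_set A ->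
  finite_set [set s : seq T | (size s <= n)%N /\ {in s, forall x, A x}].
Proof.
move=> fA; elim: n => [|n IH].
  by apply: (sub_finite_set _ (finite_set1 [::])) => -[|? ?] [].
apply: (@sub_finite_set _ _ ([set [::]] `|`
  (fun p : T * seq T => p.1 :: p.2) @`
    (A `*` [set s : seq T | (size s <= n)%N /\ {in s, forall x, A x}]))).
  move=> [|x s] [/= ns sA]; [by left | right; exists (x, s) => //=].
  split; first exact/sA/mem_head.
  by split => // y ys; apply: sA; rewrite inE ys orbT.
rewrite finite_setU; split; first exact: finite_set1.
exact/finite_image/finite_setX.
Qed.

Lemma pair_fsbig_dep (K : nmodType) (I J : choiceType) (B : set I)
    (F : I -> set J) (G : I -> J -> K) :
  finite_set B -> (forall i, B i -> finite_set (F i)) ->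
  \sum_(i \in B) \sum_(j \in F i) G i j =
  \sum_(p \in [set p | B p.1 /\ F p.1 p.2]) G p.1 p.2.
Proof.
move=> fB fF.
rewrite (@fsum_fibers K _ _ _ B (fun i => [set p | p.1 = i /\ F i p.2]) fst) //.
- apply: eq_fsbigr => i; rewrite inE => Bi.
  rewrite (reindex_fsbig (pair i) (F i)) //; split.
  + by move=> j Fj.
  + by move=> j j' _ _ [].
  + by move=> [_ j] [/= -> Fj]; exists j.
- exact: (finite_setXR fB fF).
- by move=> [i j] [].
- by move=> i [i' j] /= Bi; split=> [[-> ?]|[[_ ?] <-]].
Qed.

End FiniteSums.

(** * Complete composition *)

Section CompleteComposition.
Context {C : finType} {X : coperad C}.
Implicit Types (x y z : X) (ys zs : seq X).

(** The [ys] grafted, from the last one to the first one, on the consecutive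
    inputs k, k + 1, ... of x. The complete composition is the case k = 0. *)
Definition comp_from (k : nat) (ys : seq X) (x : X) : option X :=
  foldr (fun (iy : nat * X) (acc : option X) =>
           obind (fun w : X => pcomp w iy.1 iy.2) acc)
        (Some x) (zip (iota k (size ys)) ys).

Lemma comp_from_cons k y ys x :
  comp_from k (y :: ys) x = obind (fun w => pcomp w k y) (comp_from k.+1 ys x).
Proof. by []. Qed.

Lemma comp_from_cat k ys zs x :
  comp_from k (ys ++ zs) x =
  obind (comp_from k ys) (comp_from (k + size ys) zs x).
Proof.
elim: ys k => [|y ys IH] k /=.
  by rewrite addn0; case: comp_from.
rewrite comp_from_cons IH /= addSnnS.
by case: (comp_from _ zs x).
Qed.

Lemma comp_fromE k ys x p q :
  size p = k -> inp x = p ++ map (@out C X) ys ++ q ->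
  exists w, [/\ comp_from k ys x = Some w, out w = out x
    & inp w = p ++ flatten (map (@inp C X) ys) ++ q].
Proof.
elim: ys k p => [|y ys IH] k p pk xE.
  by exists x.
have [||w [wE wo wi]] := IH k.+1 (rcons p (out y)).
- by rewrite size_rcons pk.
- by rewrite cat_rcons xE.
rewrite cat_rcons in wi.
have : isSome (pcomp w k y).
  by rewrite pcomp_def wi -pk -[size p]addn0 onth_cat_r /= eqxx.
case vE: (pcomp w k y) => [v|] // _; exists v; split.
- by rewrite comp_from_cons wE.
- by rewrite (out_pcomp vE).
- by rewrite (inp_pcomp vE) wi -pk splice_cat /= -!catA.
Qed.

Lemma ccompE x ys : map (@out C X) ys = inp x ->
  exists z, [/\ ccomp x ys = Some z, out z = out x
    & inp z = flatten (map (@inp C X) ys)].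
Proof.
move=> h; have [|z []] := @comp_fromE 0 ys x [::] [::] erefl.
  by rewrite cats0.
by rewrite cats0 /= => zE zo zi; exists z; rewrite /ccomp h eqxx.
Qed.

Lemma ccomp_some x ys z : ccomp x ys = Some z ->
  [/\ map (@out C X) ys = inp x, comp_from 0 ys x = Some z, out z = out x
    & inp z = flatten (map (@inp C X) ys)].
Proof.
move=> h; have xE : map (@out C X) ys = inp x.
  by move: h; rewrite /ccomp; case: eqP.
have [w [wE wo wi]] := ccompE xE.
move: wE; rewrite h => -[zw]; subst w; split => //.
by move: h; rewrite /ccomp xE eqxx.
Qed.

Lemma ccomp_size x ys z : ccomp x ys = Some z -> size ys = arity x.
Proof. by case/ccomp_some => h _ _ _; rewrite /arity -h size_map. Qed.

Lemma ccomp1x x : ccomp (op1 X (out x)) [:: x] = Some x.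
Proof. by rewrite /ccomp /= inp_op1 eqxx pcomp1x. Qed.

Lemma ccompx1 x : ccomp x (map (op1 X) (inp x)) = Some x.
Proof.
rewrite /ccomp -map_comp (eq_map (@out_op1 C X)) map_id eqxx.
suff H s p : inp x = p ++ s -> comp_from (size p) (map (op1 X) s) x = Some x.
  exact: (H (inp x) [::]).
elim: s p => [|c s IH] p xE //=.
rewrite comp_from_cons -(size_rcons p c) (IH (rcons p c)) ?cat_rcons //=.
by apply: pcompx1; rewrite xE -[size p]addn0 onth_cat_r.
Qed.

Lemma comp_from_arity k zs q w :
  comp_from k zs q = Some w -> (arity q <= arity w)%N.
Proof.
elim: zs k w => [|z zs IH] k w; first by case=> ->.
rewrite comp_from_cons; case E: comp_from => [v|] //= vw.
apply: leq_trans (IH _ _ E) _; rewrite /arity (inp_pcomp vw) size_splice.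
  by have := inp_gt0 z; lia.
have := pcomp_def v k z; rewrite vw => /esym/eqP; exact: onth_size.
Qed.

(** Grafting on inputs of x o_k q that come from q amounts to grafting on q
    first. *)
Lemma comp_from_nested k j zs q x : (j + size zs <= arity q)%N ->
  obind (comp_from (k + j) zs) (pcomp x k q) =
  obind (pcomp x k) (comp_from j zs q).
Proof.
elim: zs j => [|z zs IH] j; first by rewrite /comp_from /=; case: (pcomp x k q).
move=> /= jq; have /IH {}IH : (j.+1 + size zs <= arity q)%N by rewrite addSnnS.
transitivity (obind (fun w => pcomp w (k + j) z)
  (obind (comp_from (k + j.+1) zs) (pcomp x k q))).
  by rewrite addnS; case: (pcomp x k q).
rewrite IH comp_from_cons; case wE: comp_from => [w|] //=.
by apply: pcompA; have := comp_from_arity wE; rewrite /arity in jq *; lia.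
Qed.

(** Grafting on inputs of x beyond the k-th one commutes with x o_k q, which
    shifts these inputs. *)
Lemma comp_from_disjoint k m zs q x : (k < m)%N ->
  obind (comp_from (m + arity q).-1 zs) (pcomp x k q) =
  obind (fun w => pcomp w k q) (comp_from m zs x).
Proof.
elim: zs m => [|z zs IH] m km.
  by rewrite /comp_from /=; case: (pcomp x k q).
transitivity (obind (fun w => pcomp w (m + arity q).-1 z)
  (obind (comp_from (m.+1 + arity q).-1 zs) (pcomp x k q))).
  case: (pcomp x k q) => //= v; rewrite comp_from_cons.
  by congr (obind _ (comp_from _ _ _)); lia.
rewrite IH 1?ltnW // comp_from_cons; case wE: comp_from => [w|] //=.
exact: pcompAC.
Qed.

(** Associativity of the complete composition, first with an offset k. An
    element (q, zs) of [ds] stands for a two-level tree, and [ys] lists the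
    values q o zs. *)
Lemma comp_fromA k (ds : seq (X * seq X)) (ys : seq X) x :
  map (fun d => ccomp d.1 d.2) ds = map Some ys ->
  obind (comp_from k (flatten (map snd ds))) (comp_from k (map fst ds) x) =
  comp_from k ys x.
Proof.
elim: ds ys k => [|[q zs] ds IH] [|y ys] k //= [yE /IH{}IH].
have zsq := ccomp_size yE; have [_ yE' _ _] := ccomp_some yE.
rewrite !comp_from_cons -IH.
case wE: (comp_from k.+1 (map fst ds) x) => [w|] //=.
transitivity (obind (comp_from k zs)
  (obind (fun v => pcomp v k q) (comp_from k.+1 (flatten (map snd ds)) w))).
  rewrite -comp_from_disjoint // addSn /= -zsq.
  by case: (pcomp w k q) => //= v; rewrite comp_from_cat.
case: (comp_from k.+1 _ w) => //= v.
by rewrite -[k in comp_from k]addn0 comp_from_nested ?yE' // add0n zsq.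
Qed.

Lemma out_ccomps (ds : seq (X * seq X)) (ys : seq X) :
  map (fun d => ccomp d.1 d.2) ds = map Some ys ->
  [/\ map (@out C X) ys = map (@out C X) (map fst ds),
    map (@inp C X) ys = map (fun d => flatten (map (@inp C X) d.2)) ds
    & flatten (map (fun d => inp d.1) ds) =
      map (@out C X) (flatten (map snd ds))].
Proof.
elim: ds ys => [|[q zs] ds IH] [|y ys] //=.
move=> [/ccomp_some[zo _ yo yi] /IH[-> -> e]].
by rewrite yo yi map_cat zo e.
Qed.

Lemma ccompA p (ds : seq (X * seq X)) (ys : seq X) :
  map (fun d => ccomp d.1 d.2) ds = map Some ys ->
  obind (ccomp ^~ (flatten (map snd ds))) (ccomp p (map fst ds)) = ccomp p ys.
Proof.
move=> h; have [yo yi zo] := out_ccomps h.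
rewrite {2 3}/ccomp yo; case: eqP => // po /=.
have /ccompE[w [wE _ wi]] := po; have [_ wE' _ _] := ccomp_some wE.
have := comp_fromA 0 p h; rewrite /comp_from in wE' * => <-.
by rewrite wE' /= /ccomp wi -map_comp zo eqxx.
Qed.

(** Conversely the inputs [zs] of a composition p o qs can be distributed
    among the [qs]. *)
Lemma ccomp_unnest p qs y zs x : ccomp p qs = Some y -> ccomp y zs = Some x ->
  exists2 ds, map fst ds = qs & flatten (map snd ds) = zs /\
    exists ys, map (fun d => ccomp d.1 d.2) ds = map Some ys.
Proof.
move=> /ccomp_some[_ _ _ yi] /ccomp_some[+ _ _ _]; rewrite yi => {p y yi x}.
elim: qs zs => [|q qs IH] zs /=.
  move/(congr1 size); rewrite size_map /= => /size0nil ->.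
  by exists [::] => //; split=> //; exists [::].
move=> h; have qz : (arity q <= size zs)%N.
  by rewrite -(size_map (@out C X) zs) h size_cat leq_addr.
have [/= h1 h2] : map (@out C X) (take (arity q) zs) = inp q /\
    map (@out C X) (drop (arity q) zs) = flatten (map (@inp C X) qs).
  by rewrite map_take map_drop h take_size_cat // drop_size_cat.
have [ds dsq [dsz [ys dsy]]] := IH _ h2; have [y [yE _ _]] := ccompE h1.
exists ((q, take (arity q) zs) :: ds); first by rewrite /= dsq.
split; first by rewrite /= dsz cat_take_drop.
by exists (y :: ys); rewrite /= yE dsy.
Qed.

End CompleteComposition.

(** * The composition product of series *)

Section CompositionProduct.
Context {K : fieldType} {C : finType} {X : coperad C}.
Hypothesis finX : locally_finite X.
Implicit Types (f g h : series K X) (x y z : X) (ys zs : seq X).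

Lemma arity_gt0 x : (0 < arity x)%N. Proof. exact: inp_gt0. Qed.

Lemma arity_ccomp y zs x :
  ccomp y zs = Some x -> arity x = sumn (map arity zs).
Proof.
case/ccomp_some => _ _ _ xi.
by rewrite /arity xi size_flatten /shape -map_comp.
Qed.

Lemma leq_arity_ccomp y zs x : ccomp y zs = Some x ->
  (size zs <= arity x)%N /\ {in zs, forall z, arity z <= arity x}%N.
Proof.
move/arity_ccomp => ->; elim: zs => [|z zs [IH1 IH2]] //=; split.
  by have := arity_gt0 z; lia.
move=> t; rewrite inE => /predU1P[->|/IH2]; lia.
Qed.

Lemma finite_arity_le n : finite_set [set x : X | (arity x <= n)%N].
Proof.
apply: (@sub_finite_set _ _ (\bigcup_(k in `I_n.+1) [set x : X | arity x = k])).
  by move=> x /= xn; exists (arity x).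
exact: bigcup_finite.
Qed.

(** In a locally finite colored operad an element has finitely many
    decompositions, so the sums defining the composition product are genuine. *)
Lemma finite_ccomp x :
  finite_set [set yz : X * seq X | ccomp yz.1 yz.2 = Some x].
Proof.
apply: (sub_finite_set _ (finite_setX (finite_arity_le (arity x))
  (finite_seqs (arity x) (finite_arity_le (arity x))))) => -[y zs] /= h.
have [h1 h2] := leq_arity_ccomp h; split; last by split.
by rewrite -(ccomp_size h).
Qed.

Lemma oprodBl f g h x :
  oprod (fun y => f y - g y) h x = oprod f h x - oprod g h x.
Proof.
rewrite /oprod !fsbig_finite; try exact: finite_ccomp.
rewrite -sumrB.
by apply: eq_bigr => yz _; rewrite mulrBl.
Qed.

Lemma nested_inj (T S : Type) (ds ds' : seq (T * seq S)) :
  map fst ds = map fst ds' ->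
  map (fun d => size d.2) ds = map (fun d => size d.2) ds' ->
  flatten (map snd ds) = flatten (map snd ds') -> ds = ds'.
Proof.
elim: ds ds' => [|[q zs] ds IH] [|[q' zs'] ds'] //= [-> e1] [e2 e3] e4.
have e5 : zs = zs'.
  move/(congr1 (take (size zs))): e4.
  by rewrite take_size_cat // e2 take_size_cat.
subst zs'; congr (_ :: _); apply: IH => //.
by move/(congr1 (drop (size zs))): e4; rewrite !drop_size_cat.
Qed.

(** Both sides are sums over the two-level decompositions of x, indexed on the
    left by ((y, zs), (p, qs)) with y = p o qs and x = y o zs, and on the right
    by ((p, ss), ds) with x = p o ss and [ds] decomposing each letter of [ss]. *)
Lemma oprodA f g h : oprod (oprod f g) h = oprod f (oprod g h).
Proof.
apply: funext => x; rewrite /oprod.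
under eq_fsbigr do rewrite mulr_fsuml.
rewrite pair_fsbig_dep; [|exact: finite_ccomp|by move=> *; exact: finite_ccomp].
pose pi (d : X * seq X) := ccomp d.1 d.2.
have fpi (o : option X) ss : o \in map Some ss -> finite_set [set d | pi d = o].
  by move=> /mapP[s _ ->]; exact: finite_ccomp.
transitivity (\sum_(ps \in [set ps : X * seq X | ccomp ps.1 ps.2 = Some x])
    \sum_(ds \in [set ds | map pi ds = map Some ps.2])
       f ps.1 * \prod_(d <- ds) (g d.1 * \prod_(z <- d.2) h z)); last first.
  apply: eq_fsbigr => -[p ss] _ /=.
  by rewrite -mulr_fsumr -prod_fsum ?big_map // => o; exact: fpi.
rewrite pair_fsbig_dep; [|exact: finite_ccomp|]; last first.
  by move=> [p ss] _; apply: finite_map_fiber => o; exact: fpi.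
(* The default value of [odflt] is irrelevant: p o qs is defined whenever t is
   in the domain below. *)
rewrite (reindex_fsbig
  (fun t : (X * seq X) * seq (X * seq X) =>
    let p := t.1.1 in let qs := map fst t.2 in
    ((odflt p (ccomp p qs), flatten (map snd t.2)), (p, qs)))
  [set t | ccomp t.1.1 t.1.2 = Some x /\ map pi t.2 = map Some t.1.2]).
  apply: eq_fsbigr => -[[p ss] ds] _ /=.
  by rewrite big_split /= big_flatten /= !big_map mulrA.
split.
- move=> [[p ss] ds] /= [px /ccompA A].
  by have := A p; rewrite px; case: (ccomp p _).
- have sz ss ds : map pi ds = map Some ss ->
      map (fun d => size d.2) ds = map arity (map fst ds).
    by elim: ds ss => [|d ds IH] [|s ss] //= [/ccomp_size -> /IH ->].
  move=> [[p ss] ds] [[p' ss'] ds'] /set_mem/= [_ e] /set_mem/= [_ e'].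
  move=> [_ e1 e2 e3]; have dd : ds = ds'.
    by apply: nested_inj => //; rewrite (sz _ _ e) (sz _ _ e') e3.
  subst p' ds'; congr (_, _, _); rewrite e in e'.
  by apply: (@inj_map _ _ Some) => // ? ? [].
- move=> [[y zs] [p qs]] /= [yx py].
  have [ds dq [dz [ss e]]] := ccomp_unnest py yx.
  exists ((p, ss), ds) => /=; last by rewrite dq dz py.
  by split => //; rewrite -(ccompA p e) dq py /= dz.
Qed.

Lemma op1_inj : injective (op1 X).
Proof. by move=> a b /(congr1 (@out C X)); rewrite !out_op1. Qed.

Lemma charser_op1s (A : {set C}) a :
  charser K (op1s X A) (op1 X a) = (a \in A)%:R.
Proof.
rewrite /charser; congr (nat_of_bool _)%:R; apply/idP/idP.
  by move=> /set_mem[b /= bA /op1_inj <-].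
by move=> aA; apply/mem_set; exists a.
Qed.

Lemma charser_op1s_neq0 (A : {set C}) x :
  charser K (op1s X A) x != 0 -> exists a, x = op1 X a.
Proof.
rewrite /charser; case: (boolP (x \in op1s X A)) => [/set_mem[a _ <-]|].
  by exists a.
by rewrite eqxx.
Qed.

(** Composing on the left, resp. right, with the characteristic series of units
    filters a series by output color, resp. by input colors. *)
Lemma oprod_op1sl (A : {set C}) h x :
  oprod (charser K (op1s X A)) h x = (out x \in A)%:R * h x.
Proof.
rewrite /oprod (fsbigD1 (op1 X (out x), [:: x])) /=; last 2 first.
- exact: finite_ccomp.
- exact: ccomp1x.
rewrite big_seq1 charser_op1s fsbig1 ?addr0 // => -[y zs] [/= yx ne].
have [->|/charser_op1s_neq0[a ya]] := eqVneq (charser K (op1s X A) y) 0.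
  by rewrite mul0r.
case: ne; subst y; have [zo _ _ _] := ccomp_some yx.
case: zs zo yx => [|z [|? ?]]; rewrite inp_op1 //= => -[<-].
by rewrite ccomp1x => -[->].
Qed.

Lemma oprod_op1sr (A : {set C}) f x :
  oprod f (charser K (op1s X A)) x = f x * (all (fun c => c \in A) (inp x))%:R.
Proof.
rewrite /oprod (fsbigD1 (x, map (op1 X) (inp x))) /=; last 2 first.
- exact: finite_ccomp.
- exact: ccompx1.
rewrite fsbig1 ?addr0.
  congr (_ * _); rewrite big_map; elim: (inp x) => [|c s IH] /=.
    by rewrite big_nil.
  by rewrite big_cons IH charser_op1s -natrM mulnb.
move=> -[y zs] [/= yx ne]; apply/eqP; rewrite mulf_eq0; apply/orP; right.
apply: contra_notT ne => zs0; have [zo _ _ _] := ccomp_some yx.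
have zE : zs = map (op1 X) (inp y).
  rewrite -zo; elim: zs zs0 {yx zo} => [|z zs IH] //=.
  rewrite big_cons mulf_eq0 negb_or => /andP[/charser_op1s_neq0[a ->] /IH {1}->].
  by rewrite out_op1.
by move: yx; rewrite zE ccompx1 => -[->].
Qed.

Lemma useriesE : useries K X = charser K (op1s X [set: C]%SET).
Proof.
by congr charser; apply/seteqP; split=> _ [a _ <-]; exists a => //=; rewrite inE.
Qed.

Lemma oprod1l h : oprod (useries K X) h = h.
Proof. by apply: funext => x; rewrite useriesE oprod_op1sl inE mul1r. Qed.

Lemma oprod1r f : oprod f (useries K X) = f.
Proof.
apply: funext => x; rewrite useriesE oprod_op1sr.
by rewrite (_ : all _ _ = true) ?mulr1 //; apply/allP => c _; rewrite inE.
Qed.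

(** Below, R is a set of rules, and every decomposition whose root is a rule
    decreases the measure mu from the whole to each of the parts. *)
Variables (R : set X) (mu : X -> nat).
Hypothesis mu_lt : forall y zs x z,
  R y -> ccomp y zs = Some x -> z \in zs -> (mu z < mu x)%N.

Let r : series K X := charser K R.

(** So the value at x of the product r o g only depends on the values of g at
    elements of smaller measure. *)
Lemma oprod_rules_ext g h x : (forall z, (mu z < mu x)%N -> g z = h z) ->
  oprod r g x = oprod r h x.
Proof.
move=> gh; apply: eq_fsbigr => -[y zs]; rewrite inE /= => yx.
rewrite /r /charser.
case: (boolP (y \in R)) => [/set_mem Ry|]; last by rewrite !mul0r.
congr (_ * _); apply: eq_big_seq => z zzs; apply: gh.
exact: mu_lt Ry yx zzs.
Qed.

Lemma rules_eqn_unique (c g h : series K X) :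
  (forall x, g x = c x + oprod r g x) -> (forall x, h x = c x + oprod r h x) ->
  g = h.
Proof.
move=> gE hE; apply: funext => x.
have [n] := ubnP (mu x); elim: n x => // n IH x xn.
rewrite gE hE; congr (_ + _); apply: oprod_rules_ext => z zx.
by apply: IH; apply: leq_trans zx _.
Qed.

(** The iterates of h := u + r o h, started from 0. *)
Let approx (n : nat) : series K X :=
  iter n (fun h x => useries K X x + oprod r h x) (fun=> 0).

Lemma approx_stable n m x :
  (mu x < n)%N -> (mu x < m)%N -> approx n x = approx m x.
Proof.
elim: n m x => // n IH [|m] x //= xn xm.
congr (_ + _); apply: oprod_rules_ext => z zx.
by apply: IH; lia.
Qed.

Lemma exists_star : exists h : series K X,
  forall x, h x = useries K X x + oprod r h x.
Proof.
exists (fun x => approx (mu x).+1 x) => x; rewrite {1}/approx /=.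
congr (_ + _); apply: oprod_rules_ext => z zx.
by rewrite -/(approx _) (@approx_stable (mu x) (mu z).+1).
Qed.

(** The defining equation of the inverse of u - r, which is proved to exist. *)
Lemma oinv_rules x (h := oinv (fun x => useries K X x - r x)) :
  h x = useries K X x + oprod r h x.
Proof.
set e : series K X := fun x => _ in h *.
have eE g : oprod e g = fun x => g x - oprod r g x.
  by apply: funext => t; rewrite oprodBl oprod1l.
have [s sE] := exists_star.
have es : oprod e s = useries K X.
  by rewrite eE; apply: funext => t; rewrite {1}sE addrK.
have se : oprod s e = useries K X.
  (* s o e and u both solve w = e + r o w. *)
  apply: (@rules_eqn_unique e).
    move=> t; have := congr1 (fun k => oprod k e t) es.
    by rewrite oprodA eE oprod1l => <-; rewrite subrK.
  by move=> t; rewrite oprod1r subrK.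
have : [set g | oprod e g = useries K X /\ oprod g e = useries K X] h.
  by apply: xgetPex; exists s.
by case=> + _; rewrite eE => /(congr1 (@^~ x)) <-; rewrite subrK.
Qed.

End CompositionProduct.

(** * Acyclicity of the unary rules *)

Lemma Bud_locally_finite (C : finType) (O : operad) :
  locally_finite O -> locally_finite (Bud C O).
Proof.
move=> finO n.
pose A : set (C * O * seq C) := ([set: C] `*` [set y : O | arity y = n]) `*`
  [set s : seq C | (size s <= n)%N /\ {in s, forall x, [set: C] x}].
have fA : finite_set A.
  do 2?apply: finite_setX; [exact: finite_finset|exact: finO|].
  exact/finite_seqs/finite_finset.
apply: (@sub_finite_set _ _ [set` pmap insub (fset_set A) : seq (Bud C O)]) => //.
move=> x /= xn.
rewrite mem_pmap_sub in_fset_set //; apply/mem_set; rewrite /A.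
have : size (bud_inp x) = n by [].
have := size_bud_inp x; rewrite /bud_inp /bud_op.
by case: (val x) => [[a y] u] /= -> ->.
Qed.

Section UnaryRank.
Context {C : finType} {X : coperad C}.
Hypothesis finX : locally_finite X.
Variable R : set X.
Let S : set X := [set r | R r /\ arity r = 1%N].
Hypothesis facS : finitely_factorizes S.

(** There is an edge from a to b when some unary rule has output a and
    input b. *)
Definition unary_edge : rel C :=
  fun a b => `[< exists r, [/\ S r, out r = a & inp r = [:: b]] >].

(** The number of internal nodes, which is the height of a tree whose nodes
    are all unary. *)
Fixpoint height (T : Type) (t : stree C T) : nat :=
  match t with
  | Leaf _ => 0%N
  | Node _ ts => (foldr (fun t' n => height t' + n) 0 ts).+1%N
  end.

(** If the colors in P can be followed along edges forever, there are unary
    trees of every height rooted at each of them. *)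
Lemma long_trees (P : C -> Prop) :
  (forall a, P a -> exists2 b, unary_edge a b & P b) ->
  forall n a, P a -> exists (t : stree C X) (x : X),
    [/\ Free S t, tree_out t = a, height t = n, ev t = Some x
      & out x = a /\ arity x = 1%N].
Proof.
move=> Pstep; elim=> [|n IH] a Pa.
  by exists (Leaf a), (op1 X a); rewrite /arity inp_op1 out_op1.
have [b /asboolP[r [Sr ra rb]] Pb] := Pstep _ Pa.
have [t [x [Ft tb <- tx [xb x1]]]] := IH _ Pb.
have [|z [zE zo zi]] := @ccompE _ _ r [:: x]; first by rewrite /= xb.
exists (Node r [:: t]), z; split => //=.
- by rewrite tb rb.
- by rewrite addn0.
- by rewrite tx.
- by rewrite zo /arity zi /= cats0.
Qed.

Lemma unary_acyclic a b : unary_edge a b -> connect unary_edge b a -> False.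
Proof.
move=> ab ba.
have step c : connect unary_edge c a ->
    exists2 d, unary_edge c d & connect unary_edge d a.
  move=> /connectP[[|d p] /=]; first by move=> _ <-; exists b.
  by move=> /andP[cd dp] aE; exists d => //; apply/connectP; exists p.
have long := long_trees step.
have fin : finite_set (\bigcup_(x in [set x : X | arity x = 1%N])
    [set t | Free S t /\ ev t = Some x]).
  by apply: bigcup_finite => [|x _]; [exact: finX | exact: facS].
apply: infinite_nat; apply: sub_finite_set (finite_image (@height X) fin).
move=> n _; have [t [x [Ft _ tn tx [_ x1]]]] := long n a (connect0 _ _).
by exists t => //; exists x.
Qed.

(** The number of colors reachable from a; by acyclicity it decreases strictly
    along edges. *)
Definition unary_rank (a : C) : nat := #|connect unary_edge a|.

Lemma unary_rank_lt a b : unary_edge a b -> (unary_rank b < unary_rank a)%N.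
Proof.
move=> ab; apply: proper_card; apply/properP; split.
  by apply/fintype.subsetP => c; apply: connect_trans; exact: connect1.
exists a; first exact: connect0.
by apply/negP; exact: unary_acyclic.
Qed.

(** The pair (n, rank of a) in lexicographic order, as a natural number: the
    rank is at most the number of colors. *)
Definition weight (a : C) (n : nat) : nat := (n * #|C|.+1 + unary_rank a)%N.

(** A letter of [s] is an input color of the rule r together with a positive
    size. Either r is unary and the rank of the color decreases, or r has at
    least two inputs and the size of each is less than the total size. *)
Lemma weight_lt (r : X) (s : seq (C * nat)) :
  R r -> map fst s = inp r -> {in s, forall p, 0 < p.2}%N ->
  {in s, forall p, weight p.1 p.2 < weight (out r) (sumn (map snd s))}%N.
Proof.
move=> Rr sr pos p ps; rewrite /weight.
have := size_map fst s; rewrite sr => r1.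
case: s ps sr pos r1 => [|q [|q' s]] //.
  rewrite inE => /eqP-> {p} rE _ r1 /=; rewrite addn0 ltn_add2l.
  apply: unary_rank_lt; apply/asboolP; exists r; split => //.
set t := q :: _ => pt _ pos _.
have lt : (p.2 < sumn (map snd t))%N.
  have : (0 < size (rem p t))%N by rewrite size_rem.
  case: (rem p t) (perm_to_rem pt) => [|z u] // tE _.
  have /pos : z \in t by rewrite (perm_mem tE) !inE eqxx orbT.
  have /perm_sumn -> := perm_map snd tE.
  by move=> z0; rewrite /= -[X in (X < _)%N]addn0 ltn_add2l ltn_addr.
apply: (@leq_trans (p.2.+1 * #|C|.+1)).
  by rewrite mulSn [X in (_ < X)%N]addnC ltn_add2l ltnS max_card.
by apply: leq_trans (leq_addr _ _); rewrite leq_mul2r lt orbT.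
Qed.

Lemma weight_ccomp y zs x z : R y -> ccomp y zs = Some x -> z \in zs ->
  (weight (out z) (arity z) < weight (out x) (arity x))%N.
Proof.
move=> Ry yx zzs; have [yi _ -> _] := ccomp_some yx.
pose s := map (fun z : X => (out z, arity z)) zs.
have -> : arity x = sumn (map snd s) by rewrite (arity_ccomp yx) -map_comp.
apply: (weight_lt Ry (s := s) _ _ (x := (out z, arity z))).
- by rewrite -map_comp -yi.
- by move=> _ /mapP[t _ ->]; exact: arity_gt0.
- by apply/mapP; exists z.
Qed.

End UnaryRank.

(** * Types and profiles *)

Section Types.
Context {C : finType}.
Implicit Types (gamma : {ffun C -> nat}) (alpha : ctype C).
Implicit Types (gs : seq (C * ctype C)).

(** The length of the words of type gamma. *)
Definition tdeg gamma : nat := \sum_(c : C) gamma c.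

Lemma ctype_gt0 alpha : (0 < tdeg (val alpha))%N.
Proof.
rewrite lt0n; apply: contra (valP alpha) => /eqP/eqP.
rewrite sum_nat_eq0 => /forallP h.
by apply/eqP/ffunP => c; rewrite ffunE; apply/eqP; exact: h.
Qed.

(** The sum of the types in a word of pairs (color, type). *)
Definition type_sum gs : {ffun C -> nat} :=
  [ffun c => \sum_(p <- gs) val p.2 c].

Lemma tdeg_type_sum gs :
  tdeg (type_sum gs) = sumn [seq tdeg (val p.2) | p <- gs].
Proof.
rewrite /tdeg sumnE big_map exchange_big /=.
by apply: eq_bigr => c _; rewrite ffunE.
Qed.

Lemma finite_ctype_le n :
  finite_set [set alpha : ctype C | (tdeg (val alpha) <= n)%N].
Proof.
pose A : set {ffun C -> nat} :=
  [set [ffun c => val (g c)] | g in [set: {ffun C -> 'I_n.+1}]].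
have fA : finite_set A by apply: finite_image; exact: finite_finset.
apply: (@sub_finite_set _ _ [set` pmap insub (fset_set A) : seq (ctype C)]) => //.
move=> x /= xn.
rewrite mem_pmap_sub in_fset_set //; apply/mem_set.
exists [ffun c => inord (val x c)] => //; apply/ffunP => c.
rewrite !ffunE /= inordK //.
rewrite ltnS; apply: leq_trans xn.
by rewrite /tdeg (bigD1 c) //= leq_addr.
Qed.

Lemma finite_type_sum gamma : finite_set [set gs | type_sum gs = gamma].
Proof.
apply: (sub_finite_set _ (finite_seqs (tdeg gamma) (finite_setX
  (@finite_finset C setT) (finite_ctype_le (tdeg gamma))))) => gs /= <-.
rewrite tdeg_type_sum; elim: gs => [|p gs [IH1 IH2]] //=; split.
  by rewrite -add1n leq_add ?ctype_gt0.
move=> q; rewrite inE => /predU1P[->|/IH2[_ /= h]]; split => //=.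
  exact: leq_addr.
exact: leq_trans h (leq_addl _ _).
Qed.

Lemma wtype_neq0 (u : seq C) : u != [::] -> wtype u != [ffun=> 0%N].
Proof.
case: u => // c u _; apply/eqP => /ffunP/(_ c).
by rewrite !ffunE /= eqxx.
Qed.

End Types.

Section ColorTypes.
Context {K : fieldType} {C : finType} {X : coperad C}.
Hypothesis finX : locally_finite X.

Lemma xtype_subproof (x : X) : wtype (inp x) != [ffun=> 0%N].
Proof. by apply: wtype_neq0; rewrite -size_eq0 -lt0n inp_gt0. Qed.

(** The type of the input word of x. *)
Definition xtype (x : X) : ctype C := Sub (wtype (inp x)) (xtype_subproof x).

(** The data of x recorded by its monomial in a series of color types. *)
Definition profile (x : X) : C * ctype C := (out x, xtype x).

Lemma tdeg_wtype (u : seq C) : tdeg (wtype u) = size u.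
Proof.
rewrite /tdeg; elim: u => [|c u IH] /=.
  by rewrite big1 // => c _; rewrite ffunE.
rewrite -IH -add1n -[X in (X + _)%N](@big_pred1_eq _ _ addn C c (fun=> 1%N)).
rewrite big_mkcond -big_split /=; apply: eq_bigr => b _.
by rewrite !ffunE /= eq_sym; case: eqP.
Qed.

Lemma finite_profile p : finite_set [set x : X | profile x = p].
Proof.
apply: sub_finite_set (finX (tdeg (val p.2))) => x /= <-.
by rewrite /= tdeg_wtype.
Qed.

Lemma wtype_flatten (us : seq (seq C)) c :
  wtype (flatten us) c = (\sum_(u <- us) wtype u c)%N.
Proof.
elim: us => [|u us IH] /=; first by rewrite big_nil ffunE.
by rewrite big_cons -IH !ffunE count_cat.
Qed.

Lemma profile_ccomp y zs x : ccomp y zs = Some x ->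
  map fst (map profile zs) = inp y /\
  profile x = (out y, xtype x) /\ val (xtype x) = type_sum (map profile zs).
Proof.
case/ccomp_some => yz _ xo xi; split; first by rewrite -map_comp -yz.
split; first by rewrite /profile xo.
by apply/ffunP => c; rewrite /= xi wtype_flatten !ffunE !big_map.
Qed.

Variable R : {fset X}.

(** The number of rules of output color a and input word u. *)
Definition nrules (a : C) (u : seq C) : nat :=
  #|` [fset r in R | (out r == a) && (inp r == u)]%fset|.

Let r : series K X := charser K [set x | x \in R].

Lemma sum_rules a u :
  \sum_(y \in [set y | out y = a /\ inp y = u]) r y = (nrules a u)%:R.
Proof.
rewrite /nrules -sum1_size natr_sum [RHS]fsbig_seq ?fset_uniq //=.
transitivity (\sum_(y \in [set y | out y = a /\ inp y = u] `&`
   [set y | y \in R]) (1 : K)).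
  rewrite [RHS]fsbig_mkcondr; apply: eq_fsbigr => y _.
  by rewrite /r /charser; case: (y \in [set` R]).
apply: eq_fsbigl; apply/seteqP; split => y /=; rewrite !inE.
  by move=> [[-> ->] ->]; rewrite !eqxx.
by move=> /andP[yR /andP[/eqP ? /eqP ?]].
Qed.

Variable h : series K X.
Hypothesis hE : forall x, h x = useries K X x + oprod r h x.

(** The coefficient of the series of color types of h at a given profile. *)
Definition by_profile (p : C * ctype C) : K :=
  \sum_(x \in [set x | profile x = p]) h x.

(** The equation h = u + r o h, summed over a profile. *)
Lemma by_profile_rec a alpha :
  by_profile (a, alpha) = (val alpha == wtype [:: a])%:R +
  \sum_(gs \in [set gs | type_sum gs = val alpha])
     (nrules a (map fst gs))%:R * \prod_(p <- gs) by_profile p.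
Proof.
rewrite /by_profile; under eq_fsbigr do rewrite hE.
rewrite fsbig_split; last exact: finite_profile.
congr (_ + _).
  have [e|ne] := eqVneq.
    rewrite (fsbigD1 (op1 X a)) /=; last 2 first.
    - exact: finite_profile.
    - rewrite /profile out_op1; congr pair; apply: val_inj.
      by rewrite /= inp_op1 e.
    rewrite useriesE charser_op1s inE fsbig1 ?addr0 // => x [/= xp ne].
    have [//|/charser_op1s_neq0[b xb]] :=
      eqVneq (charser K (op1s X [set: C]%SET) x) 0.
    by case: ne; rewrite xb; case: xp => <- _; rewrite xb out_op1.
  apply: fsbig1 => x /= xp; rewrite useriesE.
  have [//|/charser_op1s_neq0[b xb]] :=
    eqVneq (charser K (op1s X [set: C]%SET) x) 0.
  case/eqP: ne; case: xp => <- <-.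
  by rewrite /= xb inp_op1 out_op1.
rewrite pair_fsbig_dep; last 2 first.
- exact: finite_profile.
- by move=> *; exact: finite_ccomp.
(* Forget x, which is determined by its decomposition (y, zs). *)
pose D : set (X * seq X) :=
  [set yz | exists2 x, ccomp yz.1 yz.2 = Some x & profile x = (a, alpha)].
have fD : finite_set D.
  apply: sub_finite_set (bigcup_finite (finite_profile (a, alpha))
    (fun x _ => finite_ccomp finX x)).
  by move=> d [x dx xa]; exists x.
transitivity (\sum_(d \in D) r d.1 * \prod_(z <- d.2) h z).
  rewrite (reindex_fsbig (@snd X (X * seq X))
    [set p | profile p.1 = (a, alpha) /\ ccomp p.2.1 p.2.2 = Some p.1]) //.
  split.
  - by move=> [x d] /= [xa dx]; exists x.
  - move=> [x d] [x' d'] /set_mem/= [_ dx] /set_mem/= [_ dx'] dd; subst d'.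
    by move: dx'; rewrite dx => -[->].
  - by move=> d [x dx xa]; exists (x, d).
(* Group the decompositions (y, zs) by y and by the word of profiles of zs. *)
pose E : set (X * seq (C * ctype C)) :=
  [set yg | [/\ out yg.1 = a, map fst yg.2 = inp yg.1
              & type_sum yg.2 = val alpha]].
have fE : finite_set E.
  apply: (sub_finite_set _ (finite_setX
     (finite_arity_le finX (tdeg (val alpha)))
     (finite_type_sum (val alpha)))) => -[y gs] /= [_ yg ga]; split => //=.
  rewrite /arity -yg size_map -ga tdeg_type_sum.
  elim: gs {yg ga} => //= p gs IH.
  by rewrite -add1n leq_add ?ctype_gt0.
rewrite (@fsum_fibers K _ _ D E
  (fun yg => [set d | d.1 = yg.1 /\ map profile d.2 = yg.2])
  (fun d => (d.1, map profile d.2))) //; first last.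
- move=> [y gs] [y' zs] [/= ya yg ga]; split.
    move=> [-> zg]; subst gs; split => //.
    have [|x [yx _ _]] := @ccompE _ _ y zs; first by rewrite -yg -map_comp.
    exists x => //; have [_ [-> xt]] := profile_ccomp yx.
    by rewrite ya; congr pair; apply: val_inj; rewrite xt.
  by move=> [[x yx xa] [<- <-]].
- move=> [y zs] [x /= yx xa]; have [h1 [h2 h3]] := profile_ccomp yx.
  by move: xa; rewrite h2 => -[ya xa]; split => //=; rewrite -h3 xa.
transitivity (\sum_(yg \in E) r yg.1 * \prod_(p <- yg.2) by_profile p).
  apply: eq_fsbigr => -[y gs] _ /=.
  rewrite prod_fsum => [|p _]; last exact: finite_profile.
  rewrite mulr_fsumr (reindex_fsbig (pair y) [set ds | map profile ds = gs]) //.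
  split.
  - by move=> zs /= ->.
  - by move=> zs zs' _ _ [].
  - by move=> [y' zs] /= [-> zg]; exists zs.
rewrite (@fsum_fibers K _ _ E [set gs | type_sum gs = val alpha]
  (fun gs => [set yg | [/\ out yg.1 = a, inp yg.1 = map fst gs & yg.2 = gs]])
  snd) //.
- apply: eq_fsbigr => gs; rewrite inE /= => ga.
  rewrite -sum_rules mulr_fsuml.
  rewrite (reindex_fsbig (fun y => (y, gs))
    [set y | out y = a /\ inp y = map fst gs]) //.
  split.
  - by move=> y /= [].
  - by move=> y y' _ _ [].
  - by move=> [y gs'] /= [ya yg ->]; exists y.
- exact: finite_type_sum.
- by move=> [y gs] [].
- move=> gs [y gs'] /= ga; split; first by move=> [ya yg ->].
  by move=> [[/= ya yg _] <-].
Qed.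

End ColorTypes.

(** * Words with a given multiset of letters *)

Section Arrangements.
Local Open Scope nat_scope.
Context {C : finType} {T : eqType} (pi : T -> C).
Implicit Types (u : seq C) (m gs S : seq T).

(** The number of rearrangements of the word m that pi maps letterwise to u. *)
Definition nlift u m : nat := \sum_(gs <- permutations m | map pi gs == u) 1.

(** The first letter of such a rearrangement is a letter x of m over b. *)
Lemma nlift_cons b u m : m != [::] ->
  nlift (b :: u) m = \sum_(x <- undup m | pi x == b) nlift u (rem x m).
Proof.
move=> m0; rewrite /nlift big_mkcond (perm_big _ (permutationsE _)); last first.
  by rewrite lt0n size_eq0.
rewrite big_allpairs_dep [RHS]big_mkcond; apply: eq_bigr => x _ /=.
rewrite [in RHS]big_mkcond; case: (pi x =P b) => [->|ne].
  by apply: eq_bigr => t _; rewrite eqseq_cons eqxx.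
by rewrite big1 // => t _; rewrite eqseq_cons; case: eqP.
Qed.

Lemma prod_fact_cons b u :
  \prod_(c : C) (count_mem c (b :: u))`! =
  (count_mem b (b :: u)) * \prod_(c : C) (count_mem c u)`!.
Proof.
rewrite (bigD1 b) //= [in RHS](bigD1 b) //= eqxx factS !mulnA; congr (_ * _).
by apply: eq_bigr => c; rewrite eq_sym => /negPf ->.
Qed.

Lemma prod_fact_rem S x m : uniq S -> {subset m <= S} -> x \in m ->
  \prod_(p <- S) (count_mem p m)`! =
  count_mem x m * \prod_(p <- S) (count_mem p (rem x m))`!.
Proof.
move=> uS mS xm; rewrite (bigD1_seq x) ?mS //= [in RHS](bigD1_seq x) ?mS //=.
have H p : count_mem p m = (x == p) + count_mem p (rem x m).
  by have /permP/(_ (pred1 p)) := perm_to_rem xm.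
rewrite {1 2}H eqxx factS !mulnA; congr (_ * _).
by apply: eq_bigr => p; rewrite H eq_sym => /negPf ->.
Qed.

Lemma sum_count_undup m b :
  \sum_(x <- undup m | pi x == b) count_mem x m = count_mem b (map pi m).
Proof.
rewrite count_map -sum1_count.
rewrite -[RHS](big_undup_iterop_count addn m (fun x => pi x == b) (fun=> 1)) /=.
by apply: eq_bigr => x _; rewrite Monoid.iteropE iter_addn_0 mul1n.
Qed.

(** The count is a product of multinomial coefficients, one for each color. The
    list [S] of letters is fixed so that it does not vary in the induction. *)
Lemma nlift_fact S u m : uniq S -> {subset m <= S} -> perm_eq (map pi m) u ->
  nlift u m * \prod_(p <- S) (count_mem p m)`! =
  \prod_(c : C) (count_mem c u)`!.
Proof.
move=> uS; elim: u m => [|b u IH] m mS mu.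
  have -> : m = [::] by apply: size0nil; rewrite -(size_map pi) (perm_size mu).
  rewrite /nlift big_cons big_nil /= addn0 mul1n.
  by rewrite !big1.
have m0 : m != [::] by apply: contraTneq mu => ->; apply/negP => /perm_size.
rewrite nlift_cons // big_distrl /= prod_fact_cons.
have /permP/(_ (pred1 b)) <- := mu; rewrite -sum_count_undup big_distrl /=.
rewrite big_seq_cond [RHS]big_seq_cond; apply: eq_bigr => x /andP[].
rewrite mem_undup => xm /eqP xb.
rewrite (prod_fact_rem uS mS xm) mulnCA IH //.
  by move=> p /mem_rem /mS.
rewrite -(perm_cons b) -{1}xb -map_cons; apply: perm_trans mu.
by rewrite perm_sym perm_map // perm_to_rem.
Qed.

End Arrangements.

Section Multisets.
Context {C : finType}.
Implicit Types (phi : phimap C) (gs : seq (C * ctype C)).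

(** The word in which each p occurs phi p times, in some order. *)
Definition phi_seq phi : seq (C * ctype C) :=
  flatten [seq nseq (phi p) p | p <- finsupp phi].

(** The multiset of the letters of a word. *)
Definition phi_of gs : phimap C :=
  [fsfun p in [fset p in gs]%fset => count_mem p gs].

Lemma phi_ofE gs p : phi_of gs p = count_mem p gs.
Proof.
rewrite fsfunE !inE; case: ifP => // /negbT pgs; symmetry.
by apply/eqP; rewrite -leqn0 leqNgt -has_count has_pred1.
Qed.

Lemma count_phi_seq phi p : count_mem p (phi_seq phi) = phi p.
Proof.
rewrite count_flatten -map_comp sumnE big_map.
transitivity (\sum_(q <- finsupp phi) if q == p then phi p else 0)%N.
  apply: eq_bigr => q _ /=; rewrite count_nseq /=.
  by case: eqP => [->|]; rewrite ?mul1n.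
have [pS|pS] := boolP (p \in finsupp phi).
  by rewrite (bigD1_seq p) ?fset_uniq //= eqxx big1 ?addn0 // => q /negPf ->.
rewrite fsfun_dflt // big_seq big1 // => q qS.
by case: eqP => // qp; rewrite -qp qS in pS.
Qed.

Lemma phi_of_eq gs phi : phi_of gs = phi <-> perm_eq gs (phi_seq phi).
Proof.
split=> [<-|].
  by apply/allP => p _; rewrite /= count_phi_seq phi_ofE.
move=> /permP gsm; apply/fsfunP => p.
by rewrite phi_ofE gsm count_phi_seq.
Qed.

Lemma prod_phi_seq (A : comPzSemiRingType) phi gs (F : C * ctype C -> A) :
  perm_eq gs (phi_seq phi) ->
  \prod_(p <- gs) F p = \prod_(p <- finsupp phi) F p ^+ phi p.
Proof.
move=> gsm; rewrite (perm_big _ gsm) big_flatten big_map /=.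
by apply: eq_bigr => p _; rewrite big_nseq iter_mulr_1.
Qed.

Lemma type_sum_phi gs phi : perm_eq gs (phi_seq phi) ->
  type_sum gs = [ffun c => phi_deg phi c].
Proof.
move=> gsm; apply/ffunP => c; rewrite !ffunE (perm_big _ gsm).
rewrite big_flatten big_map /=.
by apply: eq_bigr => p _; rewrite big_nseq iter_addn_0 mulnC.
Qed.

Lemma phi_sum_count phi c : phi_sum phi c = count_mem c (map fst (phi_seq phi)).
Proof.
rewrite count_map count_flatten -map_comp sumnE big_map /phi_sum big_mkcond /=.
by apply: eq_bigr => p _ /=; rewrite count_nseq /=; case: eqP; rewrite ?mul1n.
Qed.

(** The division in the definition of phi_c! is exact: restricted to the
    letters of color c, the quotient is the value of [nlift] at the constant
    word of letter c. *)
Lemma phi_fact_dvd phi c :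
  (\prod_(p <- finsupp phi | p.1 == c) (phi p)`! %| (phi_sum phi c)`!)%N.
Proof.
pose m := [seq p <- phi_seq phi | p.1 == c].
pose S := [seq p <- finsupp phi | p.1 == c].
have mS : {subset m <= S}.
  move=> p; rewrite !mem_filter => /andP[-> /flatten_mapP[q qS]].
  by move=> /nseqP[-> _].
have uS : uniq S by rewrite filter_uniq // fset_uniq.
have WE : (\prod_(p <- S) (count_mem p m)`! =
    \prod_(p <- finsupp phi | p.1 == c) (phi p)`!)%N.
  rewrite big_filter; apply: eq_bigr => p /eqP pc.
  rewrite /m count_filter -[in RHS]count_phi_seq; congr (_`!).
  by apply: eq_count => q /=; case: eqP => //= ->; rewrite pc eqxx.
have := nlift_fact uS mS (perm_refl (map fst m)); rewrite WE.
move=> E; apply/dvdnP; exists (nlift fst (map fst m) m); rewrite E.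
rewrite (bigD1 c) //= big1 ?muln1.
  rewrite phi_sum_count /m !count_map count_filter; congr (_`!).
  by apply: eq_count => q /=; rewrite andbb.
move=> b bc; rewrite (_ : count_mem b _ = 0%N) // /m count_map count_filter.
apply/eqP; rewrite -leqn0 leqNgt -has_count; apply/hasPn => q _ /=.
by apply: contra bc => /andP[/eqP <-].
Qed.

(** The number of words of multiset phi whose word of colors is u. *)
Lemma nlift_phi phi (u : seq C) :
  nlift fst u (phi_seq phi) =
  ((wtype u == [ffun c => phi_sum phi c]) * \prod_(b : C) phi_fact phi b)%N.
Proof.
have perm_u : perm_eq (map fst (phi_seq phi)) u =
    (wtype u == [ffun c => phi_sum phi c]).
  apply/allP/eqP => [h|/ffunP h].
    apply/ffunP => c; rewrite !ffunE phi_sum_count.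
    have [cu|] := boolP (c \in map fst (phi_seq phi) ++ u).
      exact/esym/eqP/h.
    rewrite mem_cat negb_or => /andP[c1 c2].
    by rewrite (count_memPn c1) (count_memPn c2).
  by move=> c _ /=; move: (h c); rewrite !ffunE phi_sum_count => ->.
have [e|ne] := boolP (wtype u == _); last first.
  rewrite mul0n /nlift big_seq_cond big1 // => gs /andP[].
  rewrite mem_permutations => gsm /eqP gu; move: ne; rewrite -perm_u -gu.
  by rewrite perm_map // perm_sym.
rewrite mul1n; have sub : {subset phi_seq phi <= finsupp phi}.
  by move=> p /flatten_mapP[q qS] /nseqP[-> _].
rewrite -perm_u in e; have := nlift_fact (fset_uniq _) sub e.
rewrite perm_u in e; have /eqP/ffunP uE := e.
have -> : (\prod_(c : C) (count_mem c u)`! = \prod_(c : C) (phi_sum phi c)`!)%N.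
  by apply: eq_bigr => c _; have := uE c; rewrite !ffunE => ->.
have -> : (\prod_(c : C) (phi_sum phi c)`! = (\prod_(b : C) phi_fact phi b) *
    \prod_(p <- finsupp phi) (phi p)`!)%N.
  rewrite (partition_big (fun p : C * ctype C => p.1) xpredT) //= -big_split /=.
  by apply: eq_bigr => c _; rewrite /phi_fact divnK // phi_fact_dvd.
under eq_bigr do rewrite count_phi_seq.
move/eqP; rewrite eqn_pmul2r => [/eqP //|].
by apply: prodn_gt0 => p; exact: fact_gt0.
Qed.

End Multisets.

Section PhiSum.
Context {K : fieldType} {C : finType} {X : coperad C}.
Variable R : {fset X}.

Lemma card_fset_sep (T : choiceType) (A : {fset T}) (P : pred T) :
  #|` [fset x in A | P x]%fset| = (\sum_(x <- A) P x)%N.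
Proof.
rewrite card_fset_sum1 big_fset big_mkcond.
by apply: eq_bigr => x _; case: (P x).
Qed.

Lemma sum_nrules a phi :
  (\sum_(gs <- permutations (phi_seq phi)) nrules R a (map fst gs) =
   #|` [fset r in R | (out r == a) &&
          (wtype (inp r) == [ffun c => phi_sum phi c])]%fset|
    * \prod_(b : C) phi_fact phi b)%N.
Proof.
rewrite card_fset_sep big_distrl /=.
under eq_bigr do rewrite /nrules card_fset_sep.
rewrite exchange_big /=; apply: eq_bigr => r _.
rewrite -mulnb -mulnA -nlift_phi /nlift big_distrr /= [RHS]big_mkcond.
apply: eq_bigr => gs _; rewrite -mulnb [inp r == _]eq_sym.
by case: (_ == inp r); rewrite ?muln0.
Qed.

(** A sum over the finitely supported maps phi is a sum over words of pairs
    (color, type), grouped by multiset. *)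
Lemma sum_phi_seqs (F : C * ctype C -> K) (a : C) (gamma : {ffun C -> nat}) :
  \sum_(phi \in [set phi : phimap C | gamma = [ffun c => phi_deg phi c]])
     ((#|` [fset r in R | (out r == a) &&
              (wtype (inp r) == [ffun c => phi_sum phi c])]%fset|)%:R *
      (\prod_(b : C) (phi_fact phi b)%:R) *
      \prod_(p <- finsupp phi) F p ^+ phi p) =
  \sum_(gs \in [set gs | type_sum gs = gamma])
     (nrules R a (map fst gs))%:R * \prod_(p <- gs) F p.
Proof.
symmetry.
have fS := finite_type_sum gamma.
rewrite (@fsum_fibers K _ _ _
  [set phi : phimap C | gamma = [ffun c => phi_deg phi c]]
  (fun phi => [set` permutations (phi_seq phi)]) phi_of) //.
- apply: eq_fsbigr => phi _; rewrite -fsbig_seq ?permutations_uniq //.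
  rewrite -natr_prod -natrM -sum_nrules natr_sum mulr_suml.
  rewrite big_seq [RHS]big_seq; apply: eq_bigr => gs.
  by rewrite mem_permutations => /prod_phi_seq ->.
- apply: sub_finite_set (finite_image phi_of fS) => phi /= e.
  exists (phi_seq phi); last exact/phi_of_eq.
  by rewrite e; exact: type_sum_phi.
- move=> gs /= <-; apply: type_sum_phi.
  exact/phi_of_eq.
- move=> phi gs /= e; rewrite mem_permutations phi_of_eq; split=> [h|[]//].
  by split => //; rewrite e; exact: type_sum_phi.
Qed.

End PhiSum.

(** * Color types of the syntactic series *)

Lemma mono_xY_inj (C : finType) (a b : C) (alpha beta : {ffun C -> nat}) :
  mono_xY a alpha = mono_xY b beta -> a = b /\ alpha = beta.
Proof.
move=> /ffunP e; split.
  by have := e (inl a); rewrite !ffunE eqxx; case: eqP.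
by apply/ffunP => c; have := e (inr c); rewrite !ffunE.
Qed.

Lemma colt_mono_xY (K : fieldType) (C : finType) (X : coperad C)
    (g : series K X) (a : C) (alpha : ctype C) :
  colt g (mono_xY a (val alpha)) =
  \sum_(x \in [set x | profile x = (a, alpha)]) g x.
Proof.
apply: eq_fsbigl; apply/seteqP; split => x /=.
  move=> /mono_xY_inj[xa xt]; rewrite /profile xa.
  by congr pair; apply: val_inj.
by case=> <- <-.
Qed.

Lemma mem_type_word (C : finType) (alpha : {ffun C -> nat}) c :
  (c \in type_word alpha) = (0 < alpha c)%N.
Proof.
apply/flatten_mapP/idP => [[b _ /nseqP[-> //]]|c0].
by exists c; rewrite ?mem_enum // mem_nseq c0 eqxx.
Qed.

Section Derivations.
Context {K : fieldType} {C : finType} {X : coperad C}.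
Hypothesis finX : locally_finite X.
Variable R : {fset X}.
Hypothesis facR : finitely_factorizes [set r : X | r \in R /\ arity r = 1%N].

(** The inverse of u - r. *)
Definition derivations : series K X :=
  oinv (fun x => useries K X x - charser K [set r | r \in R] x).

Lemma derivationsE x : derivations x =
  useries K X x + oprod (charser K [set r | r \in R]) derivations x.
Proof.
pose mu (t : X) := weight [set r | r \in R] (out t) (arity t).
apply: (oinv_rules finX (mu := mu)) => y zs {}x z.
exact: (weight_ccomp finX (R := [set r | r \in R]) facR).
Qed.

(** By induction on the weight of (a, alpha): if a rule of output a has the
    colors of [gs] as input word, every letter of [gs] has smaller weight. *)
Lemma type_rec_unique (F G : C * ctype C -> K) :
  (forall a (alpha : ctype C), F (a, alpha) = (val alpha == wtype [:: a])%:R +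
    \sum_(gs \in [set gs | type_sum gs = val alpha])
      (nrules R a (map fst gs))%:R * \prod_(p <- gs) F p) ->
  (forall a (alpha : ctype C), G (a, alpha) = (val alpha == wtype [:: a])%:R +
    \sum_(gs \in [set gs | type_sum gs = val alpha])
      (nrules R a (map fst gs))%:R * \prod_(p <- gs) G p) ->
  F = G.
Proof.
move=> FE GE; apply: funext => p.
have [n] := ubnP (weight [set r | r \in R] p.1 (tdeg (val p.2))).
elim: n p => // n IH [a alpha] /= an; rewrite FE GE; congr (_ + _).
apply: eq_fsbigr => gs; rewrite inE /= => ga.
have [->|] := eqVneq (nrules R a (map fst gs)) 0%N; first by rewrite !mul0r.
rewrite -lt0n cardfs_gt0 => /fset0Pn[r]; rewrite !inE /=.
move=> /andP[rR /andP[/eqP ra /eqP rg]].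
congr (_ * _); apply: eq_big_seq => p pgs; apply: IH.
rewrite ltnS in an; apply: leq_trans an; rewrite -ra -ga tdeg_type_sum.
pose s := map (fun p : C * ctype C => (p.1, tdeg (val p.2))) gs.
have -> : [seq tdeg (val p.2) | p <- gs] = map snd s by rewrite -map_comp.
apply: (weight_lt finX facR rR (s := s) _ _ (x := (p.1, tdeg (val p.2)))).
- by rewrite -map_comp rg.
- by move=> _ /mapP[q _ ->]; exact: ctype_gt0.
- by apply/mapP; exists p.
Qed.

End Derivations.

Lemma syntE (K : fieldType) (B : bud_system) x :
  locally_finite (bs_operad B) ->
  synt K B x = (out x \in bs_init B)%:R * derivations (bs_rules B) x *
    (all (fun c => c \in bs_term B) (inp x))%:R.
Proof.
move=> /(@Bud_locally_finite (bs_colors B)) finX.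
by rewrite /synt (oprod_op1sr finX) (oprod_op1sl finX).
Qed.

Lemma colt_synt (K : fieldType) (B : bud_system) a
    (alpha : ctype (bs_colors B)) :
  locally_finite (bs_operad B) ->
  a \in bs_init B -> word_plus (bs_term B) (type_word (val alpha)) ->
  colt (synt K B) (mono_xY a (val alpha)) =
  by_profile (derivations (K := K) (bs_rules B)) (a, alpha).
Proof.
move=> finO aI /andP[_ /allP aT]; rewrite colt_mono_xY; apply: eq_fsbigr => x.
rewrite inE => xE; have xa : out x = a := congr1 fst xE.
have xalpha : wtype (inp x) = val alpha := congr1 (fun p => val p.2) xE.
rewrite syntE // xa aI mul1r.
rewrite (_ : all _ _ = true) ?mulr1 //; apply/allP => c cx; apply: aT.
by rewrite mem_type_word -xalpha ffunE -has_count has_pred1.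
Qed.

Theorem theorem3p3p14 (K : fieldType) (charK : [pchar K] =i pred0)
  (B : bud_system)
  (hB : unambiguous K B)
  (hO : locally_finite (bs_operad B))
  (hR : finitely_factorizes (rules1 B))
  (f : fps K (bs_colors B + bs_colors B)%type)
  (hf : forall (a : bs_colors B) (alpha : ctype (bs_colors B)),
     f (mono_xY a (val alpha)) =
       (val alpha == wtype [:: a])%:R +
       \sum_(phi \in [set phi : phimap (bs_colors B) |
                        val alpha = [ffun c => phi_deg phi c]])
          ((chi a [ffun c => phi_sum phi c])%:R *
           (\prod_(b : bs_colors B) (phi_fact phi b)%:R) *
           (\prod_(p <- finsupp phi)
               f (mono_xY p.1 (val p.2)) ^+ phi p)))
  (a : bs_colors B) (alpha : ctype (bs_colors B)) :
  a \in bs_init B ->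
  word_plus (bs_term B) (type_word (val alpha)) ->
  colt (synt K B) (mono_xY a (val alpha)) = f (mono_xY a (val alpha)).
Proof.
move=> aI aT; rewrite colt_synt //.
pose F (p : bs_colors B * ctype (bs_colors B)) := f (mono_xY p.1 (val p.2)).
rewrite -[RHS]/(F (a, alpha)); congr (_ (a, alpha)).
have finX := @Bud_locally_finite (bs_colors B) _ hO.
apply: (type_rec_unique finX hR) => {aI aT}a {}alpha.
  exact: (by_profile_rec finX (derivationsE finX hR)).
by rewrite -sum_phi_seqs; exact: hf.
Qed.
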